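(* Let $B>1$ be an integer, $\Theta_i=[\ell_i,u_i]$ ($i\in[n]$) intervals with $\ell_n\le\cdots\le\ell_1\le u_1\le\cdots\le u_n$, and $1=\delta_0\ge\delta_1\ge\cdots\ge\delta_n\ge\delta_{n+1}=0$. Consider the infinite-dimensional linear program (P$_\infty$) in variables $(f_t)_{t\in\mathcal{I}}$, $(c_i)_{i\in[n+1]}$: $$\begin{aligned}\min\ & \sum_{i=1}^{n+1}(\delta_{i-1}-\delta_i)c_i\\ \text{s.t. } & \sum_{t=1}^{\tau}(t-1+B)f_t+\tau\Big(1-\sum_{t=1}^{\tau}f_t\Big)\le\min\{\tau,B\}\cdot c_{i(\tau)}\quad(\tau\in\mathcal{I}),\\ & c_i\le c_{i+1}\ (i\in[n]),\qquad \sum_{t\in\mathcal{I}}f_t=1,\qquad f_t\ge 0\ (t\in\mathcal{I}),\quad c_i\ge 0\ (i\in[n+1]),\end{aligned}$$ and the finite-dimensional linear program (P) in variables $(f_t)_{t\in S}$, $(c_i)_{i\in[n+1]}$: $$\begin{aligned}\min\ & \sum_{i=1}^{n+1}(\delta_{i-1}-\delta_i)c_i\\ \text{s.t. } & \sum_{t\in S:\,t\le\tau}(t-1+B)f_t+\tau\Big(1-\sum_{t\in S:\,t\le\tau}f_t\Big)\le\min\{\tau,B\}\cdot c_{i(\tau)}\quad(\tau\in T),\\ & c_i\le c_{i+1}\ (i\in[n]),\qquad \sum_{t\in S}f_t=1,\qquad f_t\ge 0\ (t\in S),\quad c_i\ge 0\ (i\in[n+1]),\end{aligned}$$ with the sets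 $S$ and $T$ specified in the context. Then (P$_\infty$) can be reduced to (P): the two programs have the same optimal value, and any optimal solution $((f_t)_{t\in S},(c_i)_{i\in[n+1]})$ of (P), extended by $f_t=0$ for $t\in\mathcal{I}\setminus S$, is an optimal solution of (P$_\infty$).
   Context: $[n]=\{1,\dots,n\}$. $\mathcal{I}$ is the set of positive integers (the instances, i.e. possible last skiing days in the ski rental problem with purchase cost $B$ and rental cost $1$ per day; $f_t$ is the probability of buying on day $t$). Each $\ell_i$ is a positive integer and each $u_i$ is a positive integer or $+\infty$; $\Theta_i=[\ell_i,u_i]$ is regarded as a set of positive integers, $\Theta_0=\emptyset$, $\Theta_{n+1}=\mathcal{I}$. For $\tau\in\mathcal{I}$, $i(\tau)$ is the unique $i\in[n+1]$ with $\tau\in\Theta_i\setminus\Theta_{i-1}$. Definition of $S$ (a set of days) and $T$ (a set of instances): - If $B<u_n$, let $j=\min\{i\in[n]: u_i>B\}$; $S=\{1,2,\dots,B\}\cup\{u_j+1,u_{j+1}+1,\dots,u_n+1\}$ and $T=\{1,2,\dots,B\}\cup\{\ell_i-1,\,u_i : i\in[n]\}\cup\{u_n+1\}$. - If $u_n\le B$, $S=[B]$ and $T=[B+1]$. Since $T$ consists of instances, the value $0$ (arising as $\ell_i-1$ when $\ell_i=1$) is not counted in $T$.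
   Formalization: When some u_i = B, the day B+1 is added to S (the claim with S as printed fails, e.g. B=2, n=1, Θ_1=[1,2], δ_1=1/10); when some u_i = +∞, T also contains the instance +∞ with the limiting constraint, without which the claim fails. *)

(* Defs.v *)
(* MathComp-Analysis world. *)
From mathcomp Require Import all_boot all_order all_algebra.
From mathcomp Require Import all_classical all_reals all_analysis.

Set Implicit Arguments.
Unset Strict Implicit.
Unset Printing Implicit Defensive.

Import Order.TTheory GRing.Theory Num.Theory.
Local Open Scope classical_set_scope.
Local Open Scope ring_scope.

(* Families indexed by [n], [n+1] or {0, ..., n+1} are 1-based functions on
   nat; their values outside the stated range are never read. *)

(* Natural numbers extended with +oo, which is None. *)
Definition enat := option nat.

Definition leen (x y : enat) : bool :=
  match x, y with
  | _, None => true
  | None, Some _ => false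
  | Some a, Some b => (a <= b)%N
  end.

Definition minen (x : enat) (b : nat) : nat :=
  if x is Some a then minn a b else b.

Definition ereal_of_enat (R : realType) (x : enat) : \bar R :=
  if x is Some a then (a%:R : R)%:E else +oo%E.

Definition days : set nat := [set t | (0 < t)%N].

Definition finite_instances : set enat := Some @` days.

(* Contains +oo exactly when u_i = +oo (or i = n+1).  The value at +oo is only
   used to read the constraint of a program at the instance +oo. *)
Definition Theta (n : nat) (l : nat -> nat) (u : nat -> enat) (i : nat) :
    set enat :=
  if i == 0%N then set0
  else if i == n.+1 then [set x | leen (Some 1%N) x]
  else [set x | leen (Some (l i)) x /\ leen x (u i)].

(* i(tau); under the ordering hypotheses on l and u there is exactly one such
   i, so the default 0 is not reached. *)
Definition level (n : nat) (l : nat -> nat) (u : nat -> enat) (tau : enat) :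
    nat :=
  xget 0%N [set i | (1 <= i <= n.+1)%N /\
                    (Theta n l u i `\` Theta n l u i.-1) tau].

Definition is_first_above (n B : nat) (u : nat -> enat) (j : nat) : Prop :=
  [/\ (1 <= j <= n)%N, ~~ leen (u j) (Some B) &
      forall i, (1 <= i <= n)%N -> ~~ leen (u i) (Some B) -> (j <= i)%N].

(* u_i + 1 is not a day when u_i = +oo. *)
Definition S_days (n B : nat) (u : nat -> enat) : set nat :=
  if leen (u n) (Some B) then [set t | (1 <= t <= B)%N]
  else [set t | (1 <= t <= B)%N] `|`
       [set t | exists j i, [/\ is_first_above n B u j, (j <= i <= n)%N &
                                Some t = omap succn (u i)]].

(* The day B+1 when some u_i equals B.  Without it the reduction fails: take
   B = 2, n = 1, l_1 = 1, u_1 = 2, delta_1 = 1/10.  The infinite program has the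
   feasible point f_3 = 1, c = (1, 2), of value 11/10, whereas on the days {1, 2}
   the constraints at 1 and 2 read 1 + f_1 <= c_1 and 2 + f_2 <= 2 c_1, so that
   4/3 <= c_1 <= c_2 and the value is at least 4/3. *)
Definition boundary_day (n B : nat) (u : nat -> enat) : set nat :=
  [set t | t = B.+1 /\ exists i, (1 <= i <= n)%N /\ u i = Some B].

(* When u_i = +oo this contains the instance +oo (an endless season). *)
Definition T_instances (n B : nat) (l : nat -> nat) (u : nat -> enat) :
    set enat :=
  if leen (u n) (Some B) then Some @` [set t | (1 <= t <= B.+1)%N]
  else (Some @` [set t | (1 <= t <= B)%N] `|`
        [set tau | exists i, (1 <= i <= n)%N /\
                             (tau = Some (l i - 1)%N \/ tau = u i)] `|`
        [set omap succn (u n)]) `\ Some 0%N.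

(* Left-hand side of the constraint at tau, in \bar R.  At tau = +oo the
   convention +oo * 0 = 0 makes it the limit of the values at finite tau when f
   has finite support and total mass 1. *)
Definition expected_cost (R : realType) (B : nat) (S : set nat) (f : nat -> R)
    (tau : enat) : \bar R :=
  let St := S `&` [set t | leen (Some t) tau] in
  ((\sum_(t \in St) (t - 1 + B)%:R * f t)%:E +
   ereal_of_enat R tau * (1 - \sum_(t \in St) f t)%:E)%E.

Definition objective (R : realType) (n : nat) (delta c : nat -> R) : R :=
  \sum_(1 <= i < n.+2) (delta i.-1 - delta i) * c i.

(* The program with purchase days S and constraints at the instances T; f is
   only read on S. *)
Definition feasible (R : realType) (n B : nat) (l : nat -> nat)
    (u : nat -> enat) (S : set nat) (T : set enat) (f c : nat -> R) : Prop :=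
  [/\ forall tau, T tau ->
        (expected_cost B S f tau <=
         ((minen tau B)%:R * c (level n l u tau))%:E)%E,
      forall i, (1 <= i <= n)%N -> c i <= c i.+1,
      (\esum_(t in S) (f t)%:E = 1)%E,
      forall t, S t -> 0 <= f t &
      forall i, (1 <= i <= n.+1)%N -> 0 <= c i].

Definition optimal_value (R : realType) (n B : nat) (l : nat -> nat)
    (u : nat -> enat) (delta : nat -> R) (S : set nat) (T : set enat) :
    \bar R :=
  ereal_inf [set v | exists f c,
    feasible n B l u S T f c /\ v = (objective n delta c)%:E].

Definition is_optimal (R : realType) (n B : nat) (l : nat -> nat)
    (u : nat -> enat) (delta : nat -> R) (S : set nat) (T : set enat)
    (f c : nat -> R) : Prop :=
  feasible n B l u S T f c /\
  forall f' c', feasible n B l u S T f' c' ->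
    objective n delta c <= objective n delta c'.

Definition extend_by_zero (R : realType) (S : set nat) (f : nat -> R) (t : nat) :
    R :=
  if t \in S then f t else 0.

(* Main.v *)
Require Import Defs.
From mathcomp Require Import all_boot all_order all_algebra.
From mathcomp Require Import all_classical all_reals all_analysis.
From mathcomp Require Import ring zify.
Import Order.TTheory GRing.Theory Num.Theory.
Local Open Scope classical_set_scope.
Local Open Scope ring_scope.

(* The cost at a finite instance [k] is [sum_(t <= k) (1 - F t) + B * F k],
   where [F] is the distribution function of the purchase day; it is
   nondecreasing in [k].  Replacing [F] by its mean on each block between two
   consecutive days of [S] keeps the sums at the block ends and lowers [F]
   there, so the cost does not increase at the last instance of a block.  The
   days of [S] are placed so that an instance [tau >= B] lies in no later block
   than some [u_i] ending a block with [i <= i(tau)]; monotonicity of the cost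
   and of [c] then transfers the constraint from [u_i] to [tau].  The same
   comparison of [tau] with [u_i] shows that the constraints at [T] imply all
   the others. *)

(** * Distribution functions and the cost of a season *)

Definition psum {R : realType} (f : nat -> R) (k : nat) : R :=
  \sum_(1 <= t < k.+1) f t.

Lemma psum0 {R : realType} (f : nat -> R) : psum f 0 = 0.
Proof. by rewrite /psum big_geq. Qed.

Lemma psumS {R : realType} (f : nat -> R) k :
  psum f k.+1 = psum f k + f k.+1.
Proof. by rewrite /psum big_nat_recr. Qed.

Lemma eq_psum {R : realType} (f g : nat -> R) k :
  (forall t, (1 <= t <= k)%N -> f t = g t) -> psum f k = psum g k.
Proof. by move=> fg; apply: eq_big_nat => t; rewrite ltnS; apply: fg. Qed.

Lemma psum_cat {R : realType} (f : nat -> R) a b : (a <= b)%N ->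
  psum f b = psum f a + \sum_(a.+1 <= t < b.+1) f t.
Proof. by move=> ab; rewrite /psum -big_cat_nat. Qed.

Lemma le_psum {R : realType} (f : nat -> R) a b :
  (forall t, (0 < t)%N -> 0 <= f t) -> (a <= b)%N -> psum f a <= psum f b.
Proof.
move=> f0 ab; rewrite (psum_cat _ _ _ ab) lerDl big_nat_cond sumr_ge0// => t.
by rewrite andbT => /andP[at_ _]; apply: f0; apply: leq_trans at_.
Qed.

(* Buying on day [t] costs [t - 1 + B]; [psum f k] is the probability that the
   purchase occurs on or before the last day [k] of the season. *)
Definition season_cost {R : realType} (B : nat) (f : nat -> R) (k : nat) : R :=
  psum (fun t => (t - 1 + B)%:R * f t) k + k%:R * (1 - psum f k).

Lemma eq_season_cost {R : realType} (B : nat) (f g : nat -> R) k :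
  (forall t, (1 <= t <= k)%N -> f t = g t) ->
  season_cost B f k = season_cost B g k.
Proof.
move=> fg; rewrite /season_cost (eq_psum _ _ _ fg); congr (_ + _).
by apply: eq_psum => t tk; rewrite fg.
Qed.

(* Each day [t] with no purchase up to [t] included costs one rent. *)
Lemma season_costE {R : realType} (B : nat) (f : nat -> R) k :
  season_cost B f k =
  psum (fun t => 1 - psum f t) k + B%:R * psum f k.
Proof.
rewrite /season_cost; elim: k => [|k IH]; first by rewrite !psum0; ring.
rewrite !psumS subSS subn0 natrD -natr1.
have -> : psum (fun t => 1 - psum f t) k =
  psum (fun t => (t - 1 + B)%:R * f t) k + k%:R * (1 - psum f k)
  - B%:R * psum f k by rewrite IH; ring.
ring.
Qed.

Lemma le_season_cost {R : realType} (B : nat) (f : nat -> R) a b :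
  (forall t, (0 < t)%N -> 0 <= f t) -> (forall k, psum f k <= 1) ->
  (a <= b)%N -> season_cost B f a <= season_cost B f b.
Proof.
move=> f0 f1 ab; rewrite !season_costE lerD//.
  by apply: le_psum => // t _; rewrite subr_ge0.
by rewrite ler_wpM2l//; exact: le_psum.
Qed.

(** Once all the mass is spent, the rents [1 - psum f t] vanish and [B%:R * psum f k] stays equal to
    [B]. *)
Lemma season_cost_stable {R : realType} (B : nat) (f : nat -> R) m k :
  (forall j, (m <= j)%N -> psum f j = 1) -> (m <= k)%N ->
  season_cost B f k = season_cost B f m.
Proof.
move=> f1 mk; rewrite !season_costE (f1 k)// (f1 m)// (psum_cat _ m k)//.
by rewrite big_nat_cond big1 ?addr0// => t; rewrite andbT => /andP[/ltnW ? _];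
  rewrite f1// subrr.
Qed.

(** * Moving the purchase mass onto a prescribed set of days *)

(* Averaging [F] over each block between two consecutive elements of [S] keeps
   the partial sums of [F] at the ends of the blocks, and can only lower [F]
   there because [F] is nondecreasing. *)
Lemma block_average {R : realType} (S : set nat) (F : nat -> R) (m : nat) :
  {homo F : i j / (i <= j)%N >-> i <= j} -> 0 <= F 0%N ->
  S 1%N -> (1 <= m)%N -> S m ->
  exists G : nat -> R,
    [/\ G 0%N = 0, {homo G : i j / (i <= j)%N >-> i <= j},
        forall k, G k <= F m.-1,
        forall t, (0 < t < m)%N -> ~ S t -> G t = G t.-1 &
        forall e, (e < m)%N -> S e.+1 -> psum G e = psum F e /\ G e <= F e].
Proof.
move=> Fmono F0 S1; have [N] := ubnP m; elim: N m => // N IH m mN m1 Sm.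
(* For [m = 1] only [e = 0] qualifies, and both sums are empty. *)
have [m_eq1|m_neq1] := eqVneq m 1%N.
  exists (fun=> 0); rewrite m_eq1; split=> //=; case=> // _ _.
  by rewrite !psum0.
(* [p] is the predecessor of [m] in [S]; the last block is [p, ..., m - 1]. *)
have [p [p1 pm Sp pmax]] : exists p, [/\ (1 <= p)%N, (p < m)%N, S p &
    forall t, (p < t < m)%N -> ~ S t].
  pose P := [pred t | (1 <= t < m)%N && (t \in S)].
  have exP : exists t, P t by exists 1%N; rewrite /= mem_set//; lia.
  have ubP t : P t -> (t <= m)%N by move=> /andP[/andP[_ /ltnW]].
  case: (ex_maxnP exP ubP) => p /andP[/andP[p1 pm] /set_mem Sp] pmax.
  exists p; split => // t /andP[pt tm] /mem_set St.
  have /pmax : P t by rewrite /P /= St; lia.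
  by lia.
have [] := IH p => //; first by lia.
move=> G [G0 Gmono GF Gflat Gend].
(* [a] is the mean of [F] over the last block. Since [G <= F p.-1 <= F p <= a], appending it keeps
   monotonicity, and [a <= F m.-1] restores the bound that the induction carries. *)
pose a := (\sum_(p <= t < m) F t) / (m - p)%:R.
have mp0 : 0 < (m - p)%:R :> R by rewrite ltr0n subn_gt0.
have aE : (m - p)%:R * a = \sum_(p <= t < m) F t.
  by rewrite /a mulrC divfK// lt0r_neq0.
have Fp_a : F p <= a.
  rewrite /a ler_pdivlMr// mulr_natr -sumr_const_nat.
  by apply: ler_sum_nat => t /andP[pt _]; exact: Fmono.
have a_Fm : a <= F m.-1.
  rewrite /a ler_pdivrMr// mulr_natr -sumr_const_nat.
  by apply: ler_sum_nat => t tm; apply: Fmono; lia.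
have G_a k : G k <= a.
  by rewrite (le_trans _ Fp_a)// (le_trans (GF _))//; apply: Fmono; lia.
pose G' k := if (k < p)%N then G k else a.
exists G'; split.
- by rewrite /G' p1.
- move=> i j ij; rewrite /G'; case: ltnP => ip; case: ltnP => jp //.
  + exact: Gmono.
  + by lia.
- move=> k; rewrite /G'; case: ifP => // _; apply: le_trans a_Fm.
  exact: G_a.
- move=> t /andP[t0 tm] nSt; rewrite /G'; case: (ltnP t p) => tp.
    rewrite ifT; last by lia.
    by apply: Gflat => //; rewrite t0.
  have [tp'|tp'] := eqVneq t p; first by rewrite tp' in nSt.
  by rewrite ifF//; lia.
- move=> e em Se; have [ep|pe] := ltnP e p.
    have [<- ?] := Gend e ep Se; rewrite /G' ep; split=> //.
    by apply: eq_psum => t te; rewrite ifT//; lia.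
  (* No element of [S] lies strictly between [p] and [m], so [e] is the end of the last block. *)
  have em1 : e = m.-1.
    have [|] := ltnP e m.-1; last by lia.
    by move=> em1; case: (pmax e.+1) => //; lia.
  have Gp : psum G' p.-1 = psum F p.-1.
    have [] := Gend p.-1; [by lia | by rewrite prednK|].
    by move=> <- _; apply: eq_psum => t te; rewrite /G' ifT//; lia.
  split; last by rewrite /G' ifF ?em1//; lia.
  rewrite (psum_cat G' p.-1 e)// ?(psum_cat F p.-1 e) ?Gp//; try lia.
  rewrite em1 !prednK//; congr (_ + _); rewrite -aE.
  rewrite (eq_big_nat _ _ (F2 := fun=> a)) ?sumr_const_nat ?mulr_natl//.
  move=> t /andP[pt _].
  by rewrite /G' ifF//; lia.
Qed.

(* [g] moves the mass lying between two consecutive days of [S] onto those two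
   days, preserving the mean, and all the mass beyond [m] onto [m]. *)
Lemma support_reduction {R : realType} (B : nat) (S : set nat) (f : nat -> R)
    (m : nat) :
  (forall t, (0 < t)%N -> 0 <= f t) -> (forall k, psum f k <= 1) ->
  S 1%N -> S m -> (forall t, S t -> (1 <= t <= m)%N) ->
  exists g : nat -> R,
    [/\ forall t, 0 <= g t, forall t, ~ S t -> g t = 0,
        forall k, (m <= k)%N -> psum g k = 1,
        forall e, S e.+1 -> season_cost B g e <= season_cost B f e &
        forall k M, (m + B <= M)%N -> season_cost B g k <= season_cost B f M].
Proof.
move=> f0 f1 S1 Sm Sle; have [/andP[m1 _]] := (Sle m Sm, I).
have [||G [G0 Gmono GF Gflat Gend]] :=
  block_average S (psum f) m _ _ S1 m1 Sm.
- by move=> i j; exact: le_psum.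
- by rewrite psum0.
(* All the mass not yet spent is put on day [m]; the mass of [g] on a day is the jump of [H]
   there. *)
pose H k := if (k < m)%N then G k else 1.
have Hmono : {homo H : i j / (i <= j)%N >-> i <= j}.
  move=> i j ij; rewrite /H; case: ltnP => im; case: ltnP => jm //.
  - exact: Gmono.
  - by rewrite (le_trans (GF _)).
  - by lia.
have H0 : H 0%N = 0 by rewrite /H m1.
pose g t := H t - H t.-1.
have gsum k : psum g k = H k.
  by elim: k => [|k IH]; rewrite ?psum0// psumS IH /g /= addrC subrK.
have g0 t : 0 <= g t by rewrite subr_ge0; apply: Hmono; exact: leq_pred.
have g1 k : (m <= k)%N -> psum g k = 1.
  by move=> mk; rewrite gsum /H ltnNge mk.
have gle1 k : psum g k <= 1.
  rewrite (le_trans (le_psum _ k (k + m)%N _ _)) ?leq_addr//.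
  by rewrite g1// leq_addl.
have gS t : ~ S t -> g t = 0.
  move=> nSt; rewrite /g; case: t nSt => [|t] nSt; first by rewrite subrr.
  rewrite /H /=; have [tm|tm] := ltnP t.+1 m.
    by rewrite (ltnW tm) Gflat//= subrr.
  rewrite ifF ?subrr//; apply/negP => tm'.
  by apply: nSt; rewrite (_ : t.+1 = m)//; lia.
have compl h e : psum (fun t => 1 - h t) e = e%:R - psum h e.
  elim: e => [|e IH]; first by rewrite !psum0 subr0.
  by rewrite !psumS IH -natr1; ring.
have Hend e : (e < m)%N -> S e.+1 -> psum H e = psum (psum f) e.
  move=> em Se; have [<- _] := Gend e em Se.
  by apply: eq_psum => t /andP[_ te]; rewrite /H ifT//; lia.
exists g; split=> //.
  move=> e Se; have /andP[_ em] := Sle _ Se.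
  rewrite !season_costE gsum !compl.
  rewrite (eq_psum (psum g) H e) => [|t _]; last exact: gsum.
  rewrite Hend// lerD2l ler_wpM2l// /H em.
  by have [_ ->] := Gend e em Se.
move=> k M mM.
(* The cost of [g] is nondecreasing and constant from [m] on, so its value at [m] is the largest. *)
have km : season_cost B g k <= season_cost B g m.
  rewrite (le_trans (le_season_cost _ _ k (k + m)%N _ _ _)) ?leq_addr//.
  by rewrite (season_cost_stable B g m) ?leq_addl.
apply: (le_trans km); rewrite !season_costE g1//.
rewrite (psum_cat _ m.-1 m) ?leq_pred//.
rewrite (psum_cat (fun t => 1 - psum f t) m.-1 M); last by lia.
rewrite prednK// big_nat1 g1// subrr addr0 !compl.
rewrite (eq_psum (psum g) H) => [|t _]; last exact: gsum.
rewrite Hend ?prednK// -[leRHS]addrA lerD2l mulr1.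
(* On days [m, ..., M], of which there are at least [B], strategy [f] still rents with probability
   at least [1 - psum f M]. These rents cover [B%:R * (1 - psum f M)], the amount by which the
   purchase cost of [g] exceeds that of [f]. *)
have tail : (M.+1 - m)%:R * (1 - psum f M) <=
    \sum_(m <= t < M.+1) (1 - psum f t).
  rewrite mulr_natl -sumr_const_nat; apply: ler_sum_nat => t /andP[_ tM].
  by rewrite lerD2l lerN2; exact: le_psum.
have BM : B%:R * (1 - psum f M) <= (M.+1 - m)%:R * (1 - psum f M).
  by rewrite ler_wpM2r ?subr_ge0// ler_nat; lia.
by rewrite -lerBlDr -[X in X - _]mulr1 -mulrBr; exact: le_trans tail.
Qed.

(** * The costs and total masses of the programs as partial sums *)

Lemma fsum_psum {R : realType} (S : set nat) (h : nat -> R) m :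
  (forall t, S t -> (1 <= t <= m)%N) ->
  \sum_(t \in S) h t = psum (extend_by_zero S h) m.
Proof.
move=> Sm; rewrite /psum -(big_mkcond (fun t => t \in S)).
rewrite [RHS]bigfs ?iota_uniq//.
  by apply: eq_fsbigl; apply/seteqP; split=> t /=; rewrite inE.
by move=> t; rewrite inE => /Sm; rewrite mem_index_iota ltnS => ->.
Qed.

Lemma fsum_psum_upto {R : realType} (S : set nat) (h : nat -> R) k :
  S `<=` days ->
  \sum_(t \in S `&` [set t | leen (Some t) (Some k)]) h t =
  psum (extend_by_zero S h) k.
Proof.
move=> S1; rewrite (fsum_psum _ _ k) => [|t [/S1 t1 tk]]; last exact/andP.
apply: eq_psum => t /andP[_ tk]; rewrite /extend_by_zero in_setI.
by rewrite (mem_set (A := [set t | _])) ?andbT.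
Qed.

Lemma expected_cost_finite {R : realType} (B : nat) (S : set nat) (f : nat -> R)
    k :
  S `<=` days ->
  expected_cost B S f (Some k) = (season_cost B (extend_by_zero S f) k)%:E.
Proof.
move=> S1; rewrite /expected_cost /season_cost /= !fsum_psum_upto//.
rewrite -EFinM -EFinD; congr (_ + _)%:E; apply: eq_psum => t _.
by rewrite /extend_by_zero; case: ifP => // _; rewrite mulr0.
Qed.

(** With all the mass spent by day [m], the rental term is [+oo * 0 = 0], so the endless season
    costs as much as one of [m] days. *)
Lemma expected_cost_endless {R : realType} (B : nat) (S : set nat) (f : nat -> R)
    m :
  (forall t, S t -> (1 <= t <= m)%N) -> psum (extend_by_zero S f) m = 1 ->
  expected_cost B S f None = (season_cost B (extend_by_zero S f) m)%:E.
Proof.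
move=> Sm f1; rewrite /expected_cost /season_cost f1 subrr mulr0 addr0.
have -> : S `&` [set t | leen (Some t) None] = S by apply/setIidPl => t _.
rewrite !(fsum_psum S _ m)// f1 subrr mule0 adde0.
congr (_)%:E; apply: eq_psum => t _.
by rewrite /extend_by_zero; case: ifP => // _; rewrite mulr0.
Qed.

Lemma esum_psum {R : realType} (S : set nat) (f : nat -> R) m :
  (forall t, S t -> (1 <= t <= m)%N) -> (forall t, S t -> 0 <= f t) ->
  (\esum_(t in S) (f t)%:E)%E = (psum (extend_by_zero S f) m)%:E.
Proof.
move=> Sm f0; have finS : finite_set S.
  apply: sub_finite_set (finite_II m.+1) => t /Sm /andP[_ tm].
  by rewrite /= ltnS.
rewrite esum_fset// => [|t /set_mem St]; last by rewrite lee_fin f0.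
by rewrite fsumEFin// (fsum_psum _ _ m).
Qed.

Lemma psum_le1 {R : realType} (f : nat -> R) k :
  (forall t, days t -> 0 <= f t) -> (\esum_(t in days) (f t)%:E = 1)%E ->
  psum f k <= 1.
Proof.
move=> f0 f1; rewrite -lee_fin -f1 /psum.
apply: esum_ge; exists [set` index_iota 1 k.+1].
  split; first exact: finite_seq.
  by move=> t /=; rewrite mem_index_iota => /andP[].
by rewrite -fsbig_seq ?iota_uniq// sumEFin.
Qed.

(** * Nested intervals and the level of an instance *)

Lemma leen_trans x y z : leen x y -> leen y z -> leen x z.
Proof. by case: x y z => [x|] [y|] [z|]//=; exact: leq_trans. Qed.

Lemma interval_bounds (n : nat) (l : nat -> nat) (u : nat -> enat)
    (hl : forall i, (1 <= i < n)%N -> (l i.+1 <= l i)%N)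
    (hlu : leen (Some (l 1%N)) (u 1%N))
    (hu : forall i, (1 <= i < n)%N -> leen (u i) (u i.+1)) i :
  (1 <= i <= n)%N -> (l i <= l 1)%N /\ leen (Some (l i)) (u i).
Proof.
elim: i => // i IH /andP[_ ilen].
have [->//|i0] := posnP i.
have [|li lui] := IH; first by lia.
have lS : (l i.+1 <= l i)%N by apply: hl; lia.
split; first by lia.
apply: (leen_trans _ (u i)); last by apply: hu; lia.
by apply: leen_trans lui.
Qed.

Lemma le_upper (n : nat) (u : nat -> enat)
    (hu : forall i, (1 <= i < n)%N -> leen (u i) (u i.+1)) i k :
  (1 <= i)%N -> (i <= k <= n)%N -> leen (u i) (u k).
Proof.
move=> i1; elim: k => [|k IH]; first by lia.
move=> /andP[]; rewrite leq_eqVlt => /orP[/eqP<- _|ik kn].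
  by case: (u i) => //=.
apply: (leen_trans _ (u k)); first by apply: IH; lia.
by apply: hu; lia.
Qed.

Lemma Theta_homo (n : nat) (l : nat -> nat) (u : nat -> enat)
    (hl0 : forall i, (1 <= i <= n)%N -> (1 <= l i)%N)
    (hl : forall i, (1 <= i < n)%N -> (l i.+1 <= l i)%N)
    (hu : forall i, (1 <= i < n)%N -> leen (u i) (u i.+1)) i k :
  (i <= k <= n.+1)%N -> Theta n l u i `<=` Theta n l u k.
Proof.
elim: k => [|k IH]; first by rewrite leqn0 => /andP[/eqP-> _].
move=> /andP[]; rewrite leq_eqVlt => /orP[/eqP<- _|ik kn] //.
apply: (subset_trans (IH _)); first by lia.
rewrite /Theta [k.+1 == 0%N](_ : _ = false)//; case: (k =P 0%N) => [_ x []|k0].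
rewrite ifF; last by lia.
(* The case [k = n] passes to the set of all instances and rests on [1 <= l n]; otherwise both ends
   of the interval move outwards. *)
rewrite eqSS; case: (k =P n) => kn' x [lx xu].
  by apply: (leen_trans (Some 1%N) _ x _ lx); apply: hl0; lia.
split; last by apply: (leen_trans _ _ _ xu); apply: hu; lia.
by apply: (leen_trans _ _ x _ lx); apply: hl; lia.
Qed.

(** The least [i] with [tau] in [Theta n l u i] exists because the last set contains every instance,
    and is positive because [Theta n l u 0] is empty. So [xget] never falls back on its default. *)
Lemma levelP (n : nat) (l : nat -> nat) (u : nat -> enat) tau :
  leen (Some 1%N) tau ->
  [/\ (1 <= level n l u tau <= n.+1)%N, Theta n l u (level n l u tau) tau &
      ~ Theta n l u (level n l u tau).-1 tau].
Proof.
move=> tau1; rewrite /level; case: xgetP => [i _ [? []]//|none].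
exfalso.
have Theta_last : Theta n l u n.+1 tau by rewrite /Theta /= eqxx.
have exT : exists i, `[< Theta n l u i tau >] by exists n.+1; apply/asboolP.
case: (ex_minnP exT) => i /asboolP iT imin.
have i0 : (0 < i)%N by rewrite lt0n; apply/eqP => i0; rewrite i0 in iT.
apply: (none i); split; first by rewrite i0/= imin//; apply/asboolP.
by split=> // /asboolP /imin; lia.
Qed.

Lemma level_le (n : nat) (l : nat -> nat) (u : nat -> enat)
    (hl0 : forall i, (1 <= i <= n)%N -> (1 <= l i)%N)
    (hl : forall i, (1 <= i < n)%N -> (l i.+1 <= l i)%N)
    (hu : forall i, (1 <= i < n)%N -> leen (u i) (u i.+1)) i tau :
  leen (Some 1%N) tau -> Theta n l u i tau -> (level n l u tau <= i)%N.
Proof.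
move=> tau1 iT; have [/andP[lev1 levn] _ nT] := levelP n l u tau tau1.
rewrite leqNgt; apply/negP => ilev; apply: nT.
by apply: (Theta_homo n l u hl0 hl hu i) iT; lia.
Qed.

(** This finds the [u i] with which [tau] is compared in both reductions. Level [n.+1] does not put
    [tau] beyond every [u k], as [tau] may lie below every [l k]; any [u k] above [tau] then
    serves. *)
Lemma least_upper (n : nat) (l : nat -> nat) (u : nat -> enat) tau :
  leen (Some 1%N) tau ->
  (level n l u tau = n.+1 /\ forall k, (1 <= k <= n)%N -> ~~ leen tau (u k)) \/
  exists i, [/\ (1 <= i <= n)%N, leen tau (u i) & (i <= level n l u tau)%N].
Proof.
move=> tau1; have [levn levT _] := levelP n l u tau tau1.
have [lev_eq|lev_neq] := eqVneq (level n l u tau) n.+1.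
  have [[k [kn tauk]]|none] :=
      pselect (exists k, (1 <= k <= n)%N /\ leen tau (u k)).
    by right; exists k; split=> //; rewrite lev_eq; lia.
  by left; split=> // k kn; apply/negP => tauk; apply: none; exists k.
right; exists (level n l u tau); move: levT; rewrite /Theta ifF; last by lia.
by rewrite (negbTE lev_neq) => -[_ ?]; split=> //; lia.
Qed.

Lemma Theta_upper (n : nat) (l : nat -> nat) (u : nat -> enat) i tau :
  (1 <= i <= n)%N -> leen (Some (l i)) tau -> leen tau (u i) ->
  Theta n l u i tau.
Proof. by move=> ilen li ui; rewrite /Theta !ifF//; lia. Qed.

Lemma nondecreasing_levels {R : realType} (n : nat) (c : nat -> R) i k :
  (forall i, (1 <= i <= n)%N -> c i <= c i.+1) ->
  (1 <= i)%N -> (i <= k)%N -> (k <= n.+1)%N -> c i <= c k.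
Proof.
move=> cS i1; elim: k => [|k IH]; first by lia.
rewrite leq_eqVlt => /orP[/eqP<-//|ik kn].
by apply: le_trans (IH _ _) (cS _ _); lia.
Qed.

(** * From the infinite program to finitely many days *)

(** Only [f] is replaced, so the objective is unchanged. The constraints are obtained at every
    instance, [+oo] included, which covers both forms of [T]. *)
Lemma reduced_constraints {R : realType} (n B : nat) (l : nat -> nat)
    (u : nat -> enat) (S : set nat) (f c : nat -> R)
    (hn : (1 <= n)%N) (hB : (1 <= B)%N)
    (hl0 : forall i, (1 <= i <= n)%N -> (1 <= l i)%N)
    (hl : forall i, (1 <= i < n)%N -> (l i.+1 <= l i)%N)
    (hlu : leen (Some (l 1%N)) (u 1%N))
    (hu : forall i, (1 <= i < n)%N -> leen (u i) (u i.+1)) :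
  (forall t, (1 <= t <= B)%N -> S t) ->
  (forall i a, (1 <= i <= n)%N -> u i = Some a -> (B <= a)%N -> S a.+1) ->
  (exists M, forall t, S t -> (1 <= t <= M)%N) ->
  feasible n B l u days finite_instances f c ->
  exists g, feasible n B l u S [set tau | leen (Some 1%N) tau] g c.
Proof.
move=> Ssmall Supper [N SN] [fcost cmono fsum f0 c0].
have S1 : S 1%N by apply: Ssmall; lia.
have [m [Sm Sle]] : exists m, S m /\ forall t, S t -> (1 <= t <= m)%N.
  have exS : exists t, t \in S by exists 1%N; rewrite mem_set.
  have ubS t : t \in S -> (t <= N)%N by move=> /set_mem /SN /andP[].
  case: (ex_maxnP exS ubS) => m /set_mem Sm mmax; exists m; split=> // t St.
  by case/andP: (SN t St) => -> _; apply: mmax; rewrite mem_set.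
have f1 k : psum f k <= 1 by exact: psum_le1.
have [g [g0 gS g1 gend gtail]] := support_reduction B S f m f0 f1 S1 Sm Sle.
have extg : extend_by_zero S g = g.
  apply/funext => t; rewrite /extend_by_zero; case: ifP => // /negP nS.
  by rewrite gS// => /mem_set.
have gle1 k : psum g k <= 1.
  rewrite (le_trans (le_psum _ k (k + m)%N _ _)) ?leq_addr//.
  by rewrite g1// leq_addl.
have fcostE k : (0 < k)%N ->
    season_cost B f k <= (minn k B)%:R * c (level n l u (Some k)).
  move=> k0; have fk : finite_instances (Some k) by exists k.
  have := fcost _ fk; rewrite expected_cost_finite// lee_fin.
  congr (_ <= _); apply: eq_season_cost => t /andP[t0 _].
  by rewrite /extend_by_zero mem_set.
have late tau k : leen (Some B) tau ->
    season_cost B g k <= B%:R * c (level n l u tau) ->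
    ((season_cost B g k)%:E <= ((minen tau B)%:R * c (level n l u tau))%:E)%E.
  by case: tau => [t|]//= Bt; rewrite (minn_idPr Bt) lee_fin.
exists g; split=> //.
- move=> tau tau1.
  (* An endless season is replaced by one of [m] days, [m] being the last day of [S]. *)
  have [k [kcost ktau]] : exists k,
      expected_cost B S g tau = (season_cost B g k)%:E /\
      leen (Some k) tau /\ (tau = Some k \/ tau = None).
    case: tau tau1 => [k|] _.
      exists k; rewrite expected_cost_finite ?extg//; last first.
        by move=> t /Sle /andP[].
      by split=> //; split=> /=; [|left].
    exists m; rewrite (expected_cost_endless _ _ _ m)// ?extg ?g1//.
    by split=> //; split=> //; right.
  rewrite kcost.
  (* If [tau < B], then [tau + 1] is in [S], so [tau] ends a block and the constraint of [f] at
     [tau] itself suffices. *)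
  have [tauB|] := boolP (leen (Some B) tau); last first.
    case: tau tau1 kcost ktau => [t|]//= t0 _ [kt [[tk]|//]].
    rewrite tk -ltnNge => kB.
    subst t; rewrite lee_fin (le_trans (gend _ _)) ?fcostE//.
    by apply: Ssmall; lia.
  apply: late => //.
  (* It is enough to dominate the cost of [g] by that of [f] at some [M >= B] in [Theta n l u i]
     with [i] at most the level of [tau]: the factor is [B] at both instances and [c] is
     nondecreasing. *)
  have bound i M : (1 <= i)%N -> (i <= level n l u tau)%N -> (B <= M)%N ->
      Theta n l u i (Some M) -> season_cost B g k <= season_cost B f M ->
      season_cost B g k <= B%:R * c (level n l u tau).
    move=> i1 ilev BM iM kM; apply: (le_trans kM).
    have M0 : (0 < M)%N by lia.
    rewrite (le_trans (fcostE _ M0))// (minn_idPr BM) ler_wpM2l//.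
    have [/andP[lev1 _] _ _] := levelP n l u (Some M) M0.
    have [/andP[_ levn] _ _] := levelP n l u tau tau1.
    apply: (nondecreasing_levels n) => //.
    exact: leq_trans (level_le n l u hl0 hl hu i (Some M) M0 iM) ilev.
  have [[levE _]|[i [ilen taui ilev]]] := least_upper n l u tau tau1.
    (* Beyond every [u k] the level is the top one, so any late instance may serve; [m + B] is where
       the tail estimate starts. *)
    apply: (bound n.+1 (m + B)%N) => //;
      [by rewrite levE|exact: leq_addl| |exact: gtail].
    by rewrite /Theta /= eqxx /=; lia.
  have [li1 liui] := interval_bounds n l u hl hlu hu i ilen.
  (* A finite [u i = a] is at least [B], so [a + 1] is in [S] and [a] ends a block. *)
  case ui : (u i) taui liui => [a|] taui liui.
    have [ka aB] : (k <= a)%N /\ (B <= a)%N.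
      case: (tau) tauB taui ktau => [t|]//= Bt ta [kt _]; lia.
    apply: (bound i a) => //; first by lia.
      by apply: Theta_upper => //; rewrite ui /=.
    rewrite (le_trans (le_season_cost _ _ k a (fun t _ => g0 t) gle1 ka))//.
    by apply: gend; exact: (Supper i).
  (* Here [u i = +oo]: the summand [m + B] serves the tail estimate, and [l 1] puts the instance
     above [l i]. *)
  apply: (bound i (m + B + l 1)%N) => //; [by lia|by lia| |apply: gtail; lia].
  by apply: Theta_upper => //; rewrite ?ui//=; lia.
- by rewrite (esum_psum _ _ m) ?extg ?g1.
Qed.

(** * From the finite program to all instances *)

(** Past [B] the factor is constant and the cost nondecreasing, so the constraint at [t] follows
    from the one at some [u i >= t] of no higher level. If [t] exceeds every [u k], the instance [m]
    takes that role, since the cost no longer changes after it. *)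
Lemma extended_constraints {R : realType} (n B : nat) (l : nat -> nat)
    (u : nat -> enat) (S : set nat) (T : set enat) (f c : nat -> R)
    (hn : (1 <= n)%N) (hB : (1 <= B)%N)
    (hl0 : forall i, (1 <= i <= n)%N -> (1 <= l i)%N)
    (hl : forall i, (1 <= i < n)%N -> (l i.+1 <= l i)%N)
    (hlu : leen (Some (l 1%N)) (u 1%N))
    (hu : forall i, (1 <= i < n)%N -> leen (u i) (u i.+1)) :
  (exists M, forall t, S t -> (1 <= t <= M)%N) ->
  (forall t, (1 <= t <= B)%N -> T (Some t)) ->
  (forall i, (1 <= i <= n)%N -> ~~ leen (u i) (Some B) -> T (u i)) ->
  (forall a, u n = Some a -> exists m,
     [/\ T (Some m), (B < m)%N, (m <= (maxn a B).+1)%N &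
         forall t, S t -> (t <= m)%N]) ->
  feasible n B l u S T f c ->
  feasible n B l u days finite_instances (extend_by_zero S f) c.
Proof.
move=> [M SM] Tsmall Tupper Tlast [fcost cmono fsum f0 c0].
set g := extend_by_zero S f.
have Sdays : S `<=` days by move=> t /SM /andP[].
have g0 t : 0 <= g t.
  by rewrite /g /extend_by_zero; case: ifP => // /set_mem; exact: f0.
have gm m : (forall t, S t -> (1 <= t <= m)%N) -> psum g m = 1.
  by move=> Sm; have := esum_psum S f m Sm f0; rewrite fsum => -[].
have g1 k : psum g k <= 1.
  rewrite -(gm (k + M)%N) => [|t /SM]; last by lia.
  by apply: le_psum => //; rewrite leq_addr.
split=> //.
- move=> tau [t t0 <-]; rewrite expected_cost_finite// lee_fin /=.
  rewrite (eq_season_cost _ _ g) => [|s /andP[s0 _]]; last first.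
    by rewrite /extend_by_zero mem_set.
  have [tB|Bt] := leqP t B.
    have := fcost (Some t) _.
    rewrite expected_cost_finite// lee_fin /= (minn_idPl tB).
    by apply; apply: Tsmall; rewrite t0.
  have [/andP[_ levtn] _ _] := levelP n l u (Some t) t0.
  have late sigma s i : T sigma -> leen (Some B.+1) sigma ->
      expected_cost B S f sigma = (season_cost B g s)%:E ->
      Theta n l u i sigma -> (1 <= i)%N -> (i <= level n l u (Some t))%N ->
      season_cost B g t <= season_cost B g s ->
      season_cost B g t <= B%:R * c (level n l u (Some t)).
    move=> Ts Bs es is_ i1 ilev /le_trans; apply.
    have s1 : leen (Some 1%N) sigma by case: sigma Bs {Ts es is_} => //= ?; lia.
    have := fcost _ Ts; rewrite es lee_fin => /le_trans; apply.
    have -> : minen sigma B = B by case: sigma Bs {Ts es is_ s1} => //= ?; lia.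
    have [/andP[lev1 _] _ _] := levelP n l u sigma s1.
    rewrite ler_wpM2l//; apply: (nondecreasing_levels n) => //.
    exact: leq_trans (level_le n l u hl0 hl hu i sigma s1 is_) ilev.
  have mono a b : (a <= b)%N -> season_cost B g a <= season_cost B g b.
    exact: le_season_cost.
  have [[levE above]|[i [ilen tui ilev]]] := least_upper n l u (Some t) t0.
    case un : (u n) => [a|]; last by have := above n; rewrite un /=; lia.
    have [m [Tm Bm ma Sm]] := Tlast a un.
    (* Both [a] and [B] are below [t], hence [m <= t]. *)
    have am : (a < t)%N by have := above n; rewrite un /= -ltnNge; apply; lia.
    apply: (late (Some m) m n.+1) => //; rewrite ?levE//.
    + by rewrite expected_cost_finite.
    + by rewrite /Theta /= eqxx /=; lia.
    rewrite (season_cost_stable B g m)//; last by lia.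
    move=> j mj; apply: gm => s Ss; have /andP[-> _] := SM s Ss.
    exact: leq_trans (Sm s Ss) mj.
  have [li1 liui] := interval_bounds n l u hl hlu hu i ilen.
  have Bui : leen (Some B.+1) (u i) by apply: leen_trans tui.
  have Tui : T (u i).
    by apply: Tupper => //; case: (u i) Bui => //= a; lia.
  have iui : Theta n l u i (u i).
    by apply: Theta_upper => //; case: (u i) => /=.
  case ui : (u i) => [a|]; rewrite ui in Tui iui Bui tui.
    apply: (late (Some a) a i) => //; rewrite ?expected_cost_finite//.
      lia.
    exact: mono.
  (* The constraint at [+oo] is read at day [M + t], which is past all of [S] and not before [t]. *)
  apply: (late None (M + t)%N i) => //; first 1 last; first by lia.
    by apply: mono; rewrite leq_addl.
  rewrite (expected_cost_endless _ _ _ (M + t)%N)//; last apply: gm.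
    by move=> s /SM; lia.
  by move=> s /SM; lia.
- move: fsum; rewrite esum_mkcond => <-; rewrite [LHS]esum_mkcond.
  apply: eq_esum => t _; rewrite /g /extend_by_zero.
  have [tS|tS] := boolP (t \in S); last by case: ifP.
  by rewrite mem_set//; apply: Sdays; exact: set_mem.
Qed.

(** * The concrete sets [S] and [T], and equality of the programs *)

Lemma S_days_bounded (n B : nat) (u : nat -> enat) :
  exists M, forall t, (S_days n B u `|` boundary_day n B u) t ->
    (1 <= t <= M)%N.
Proof.
(* An infinite [u i] yields no day and counts as 0 in the maximum. *)
exists (B + \max_(1 <= i < n.+1) odflt 0%N (u i)).+1 => t.
case; last by move=> [-> _]; lia.
rewrite /S_days; case: ifP => _ /=; first by lia.
case=> [|[j [i [[/andP[j1 _] _ _] /andP[ji ilen]]]]] /=; first by lia.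
case ui : (u i) => [a|]//= [->].
have : (odflt 0 (u i) <= \max_(1 <= i < n.+1) odflt 0 (u i))%N.
  by apply: leq_bigmax_seq => //; rewrite mem_index_iota; lia.
by rewrite ui /=; lia.
Qed.

(** The boundary day handles [a = B]. For [a > B], the index [i] is at least the first [j] with
    [u j > B], so [u i + 1] is among the days of [S_days]. *)
Lemma S_days_upper (n B : nat) (u : nat -> enat)
    (hu : forall i, (1 <= i < n)%N -> leen (u i) (u i.+1)) i a :
  (1 <= i <= n)%N -> u i = Some a -> (B <= a)%N ->
  (S_days n B u `|` boundary_day n B u) a.+1.
Proof.
move=> ilen ui; rewrite leq_eqVlt => /orP[/eqP Ba|Ba].
  by right; split; [rewrite Ba|exists i; rewrite Ba].
left; rewrite /S_days ifF; last first.
  apply/negbTE/negP => unB; have [i1 iltn] := andP ilen.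
  have := leen_trans _ _ _ (le_upper n u hu i n i1 _) unB.
  by rewrite ui /= iltn leqnn; lia.
pose P k := (1 <= k <= n)%N && ~~ leen (u k) (Some B).
have exP : exists k, P k by exists i; rewrite /P ilen ui /= -ltnNge.
case: (ex_minnP exP) => j /andP[jn uj] jmin.
right; exists j, i; split; last by rewrite ui.
  by split=> // k kn uk; apply: jmin; rewrite /P kn.
by rewrite jmin ?/P ?ilen ?ui /= -?ltnNge//; lia.
Qed.

Theorem theorem4 (R : realType) (n B : nat) (l : nat -> nat) (u : nat -> enat)
    (delta : nat -> R)
    (hn : (1 <= n)%N) (hB : (1 < B)%N)
    (hl0 : forall i, (1 <= i <= n)%N -> (1 <= l i)%N)
    (hl : forall i, (1 <= i < n)%N -> (l i.+1 <= l i)%N)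
    (hlu : leen (Some (l 1%N)) (u 1%N))
    (hu : forall i, (1 <= i < n)%N -> leen (u i) (u i.+1))
    (hd0 : delta 0%N = 1)
    (hd : forall i, (i <= n)%N -> delta i.+1 <= delta i)
    (hdn : delta n.+1 = 0) :
  let S := S_days n B u `|` boundary_day n B u in
  let T := T_instances n B l u in
  optimal_value n B l u delta days finite_instances =
    optimal_value n B l u delta S T /\
  (forall f c : nat -> R, is_optimal n B l u delta S T f c ->
     is_optimal n B l u delta days finite_instances (extend_by_zero S f) c).
Proof.
move=> S T; have B1 : (1 <= B)%N by exact: ltnW.
have restrict f c : feasible n B l u days finite_instances f c ->
    exists g, feasible n B l u S T g c.
  move=> fc; have Tpos : T `<=` [set tau | leen (Some 1%N) tau].
    rewrite /T /T_instances; case: ifP => _ [t|] //=.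
      by case=> s ? [<-]; lia.
    by case=> _; case: t => // /(_ erefl).
  have [||g [gcost gmono gsum g0 c0]] :=
    reduced_constraints n B l u S f c hn B1 hl0 hl hlu hu _ _
      (S_days_bounded n B u) fc.
  - by move=> t tB; left; rewrite /S_days; case: ifP => _ //; left.
  - exact: S_days_upper.
  by exists g; split=> // tau /Tpos; exact: gcost.
have extend f c : feasible n B l u S T f c ->
    feasible n B l u days finite_instances (extend_by_zero S f) c.
  apply: extended_constraints => //; first exact: S_days_bounded.
  - move=> t tB; rewrite /T /T_instances; case: ifP => _.
      by exists t => //=; lia.
    split; last by case=> t0; rewrite t0 in tB.
    by left; left; exists t.
  - move=> i ilen uiB; have [i1 iltn] := andP ilen.
    rewrite /T /T_instances ifF; last first.
      apply/negbTE; apply: contra uiB; apply: leen_trans.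
      by apply: (le_upper n u hu) => //; rewrite iltn /=.
    split; last by move=> /= ui0; rewrite ui0 in uiB.
    by left; right; exists i; split=> //; right.
  (* The instance required is [B + 1] when [u n <= B] and [u n + 1] otherwise; no day of [S] is
     later. *)
  - move=> a una; rewrite /T /T_instances /S /S_days una /=; case: ifP => aB.
      exists B.+1; split=> //; [by exists B.+1 => //=; lia|lia|].
      by move=> t [/=|[-> _]//]; lia.
    exists a.+1; split; [|by lia|by lia|].
      by split; [right|].
    move=> t [[/=|[j [i [[/andP[j1 _] _ _] /andP[ji ilen] ui]]]]|[-> _]];
      try lia.
    have := le_upper n u hu i n _ _; rewrite una ilen leqnn.
    by case: (u i) ui => [b|]//= [->]; apply; lia.
split; last first.
  move=> f c [fc opt]; split; first exact: extend.
  by move=> f' c' /restrict[g] /opt.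
(* Both passages keep [c], so the two sets of attained objective values coincide. *)
rewrite /optimal_value; congr ereal_inf; apply/seteqP; split.
  by move=> _ [f [c [/restrict[g gc] ->]]]; exists g, c.
by move=> _ [f [c [/extend fc ->]]]; exists (extend_by_zero S f), c.
Qed.
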